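(* Let $p$ be a prime, let $T$ be a finite abelian $p$-group with a tame quadratic function $\psi\colon T\to\mathbb{Q}/\mathbb{Z}$, let $a$ be an integer prime to $p$, and let $|T/T^\perp|=p^e$. For $p$ odd let $\ell_p(a)=0$ if $a$ is a quadratic residue mod $p$ and $\ell_p(a)=1$ if not. Let $\ell_2(a)=0$ if $a\equiv\pm1\bmod 8$ and $\ell_2(a)=1$ if $a\equiv\pm3\bmod8$. Then, in $\mathbb{Q}/\mathbb{Z}$, for $p$ odd $$\beta(a\cdot\psi)=\beta(\psi)+\frac{\ell_p(a)\cdot e}{2},$$ and for $p=2$ $$\beta(a\cdot\psi)=a\cdot\beta(\psi)+\frac{\ell_2(a)\cdot e}{2}.$$
   Context: A function $\psi\colon T\to\mathbb{Q}/\mathbb{Z}$ on a finite abelian group is quadratic if $\psi(ax)=a^2\psi(x)$ for all $a\in\mathbb{Z}$, $x\in T$, and $b(x,y)=\psi(x+y)-\psi(x)-\psi(y)$ is bilinear. $T^\perp=\{t\in T: b(t,s)=0\ \forall s\in T\}$. $\psi$ is tame if $\psi|_{T^\perp}=0$. $(a\cdot\psi)(x)=a\,\psi(x)$. The Gauss sum is $G(\psi)=\sum_{t\in T}e^{2\pi i\psi(t)}$, and when $G(\psi)\neq0$ (which holds exactly when $\psi$ is tame) the phase $\beta(\psi)$ is defined by $G(\psi)=|G(\psi)|\,e^{2\pi i\beta(\psi)}$. If $\psi$ is tame and $a$ is prime to $|T|$, then $a\cdot\psi$ is tame. *)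

(* Defs.v *)
From HB Require Import structures.
From mathcomp Require Import all_boot all_order all_algebra all_fingroup all_solvable.
From mathcomp Require Import generic_quotient ring_quotient complex.
From mathcomp Require Import all_classical all_reals all_analysis.

Set Implicit Arguments.
Unset Strict Implicit.
Unset Printing Implicit Defensive.

Import Order.TTheory GRing.Theory Num.Theory.
Local Open Scope ring_scope.
Local Open Scope complex_scope.
Local Open Scope quotient_scope.

(* Num.int is a qualifier; the quotient construction needs a bare predicate
   carrying a zmodClosed instance. *)
Definition intrat : {pred rat} := fun x => x \is a Num.int.

Fact intrat_zmod_closed : zmod_closed intrat.
Proof.
split=> [|x y xZ yZ]; rewrite unfold_in; first exact: int_num0.
exact: rpredB xZ yZ.
Qed.
HB.instance Definition _ := GRing.isZmodClosed.Build rat intrat intrat_zmod_closed.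

Definition QZ : Type := Quotient.quot intrat.
HB.instance Definition _ := GRing.Zmodule.on QZ.
HB.instance Definition _ := EqQuotient.on QZ.

Definition toQZ (x : rat) : QZ := \pi_QZ x.

Lemma toQZ_eq (x y : rat) : (toQZ x == toQZ y) = (x - y \is a Num.int).
Proof. by rewrite /toQZ; apply/idP/idP; rewrite -Quotient.idealrBE. Qed.

Lemma toQZD (x y : rat) : toQZ (x + y) = toQZ x + toQZ y.
Proof. exact: Quotient.pi_add. Qed.

Section Quadratic.
Variable T : finZmodType.
Implicit Types psi : T -> QZ.

Definition polar psi (x y : T) : QZ := psi (x + y) - psi x - psi y.

Definition quadratic psi : Prop :=
  (forall (a : int) (x : T), psi (x *~ a) = psi x *~ (a ^+ 2)) /\
  (forall x y z : T, polar psi (x + y) z = polar psi x z + polar psi y z) /\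
  (forall x y z : T, polar psi x (y + z) = polar psi x y + polar psi x z).

Definition perp psi : {set T} :=
  [set t : T | [forall s : T, polar psi t s == 0]].

Definition tame psi : Prop := forall t : T, t \in perp psi -> psi t = 0.

Definition scale_quad (a : int) psi : T -> QZ := fun x => psi x *~ a.

End Quadratic.

Section Gauss.
Variable R : realType.

(* exp (2 pi i r), written cos + i sin as the library has no complex exp. *)
Definition expi2pi (r : R) : R[i] := cos (pi *+ 2 * r) +i* sin (pi *+ 2 * r).

(* Evaluated at a chosen rational representative; expQZ_toQZ shows that the
   choice is irrelevant. *)
Definition expQZ (b : QZ) : R[i] := expi2pi (ratr (repr b)).

Lemma expi2pi_int (r : R) (m : int) : expi2pi (r + m%:~R) = expi2pi r.
Proof.
have H n (s : R) : expi2pi (s + n%:R) = expi2pi s.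
  rewrite /expi2pi mulrDr mulr_natr (periodicn (@cosD2pi R)).
  by rewrite (periodicn (@sinD2pi R)).
case: m => n; first exact: H.
by rewrite NegzE mulrNz -(H n.+1) subrK.
Qed.

Lemma expQZ_toQZ (x : rat) : expQZ (toQZ x) = expi2pi (ratr x).
Proof.
have /intrP[m hm] : repr (toQZ x) - x \is a Num.int.
  by rewrite -toQZ_eq {1}/toQZ reprK.
rewrite /expQZ -[RHS](expi2pi_int _ m) -(ratr_int R m) -hm -rmorphD.
by rewrite addrC subrK.
Qed.

Variable T : finZmodType.

Definition gauss (psi : T -> QZ) : R[i] := \sum_(t : T) expQZ (psi t).

(* The phase is only meaningful when the Gauss sum does not vanish. *)
Definition is_phase (psi : T -> QZ) (b : QZ) : Prop :=
  gauss psi != 0 /\ gauss psi = `|gauss psi| * expQZ b.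

(* Takes the junk value 0 when no phase exists in Q/Z. *)
Definition phase (psi : T -> QZ) : QZ := xget 0 [set b | is_phase psi b]%classic.
End Gauss.

(* Only used for a prime to p; a is a residue when it is a square mod p. *)
Definition ell (p : nat) (a : int) : nat :=
  if p == 2%N then ~~ ((a == 1 %[mod 8])%Z || (a == -1 %[mod 8])%Z)
  else ~~ [exists x : 'I_p, ((x%:Z) ^+ 2 == a %[mod p])%Z].

(* Main.v *)
Require Import Defs.
From mathcomp Require Import all_boot all_order all_algebra all_fingroup all_solvable.
From mathcomp Require Import all_classical all_reals all_analysis.
From mathcomp Require Import complex generic_quotient finfield zify ring lra.
Import GRing.Theory Num.Theory Order.TTheory.
Set Implicit Arguments.
Unset Strict Implicit.
Unset Printing Implicit Defensive.
Local Open Scope ring_scope.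
Local Notation "z ^*" := (conjc z) : ring_scope.

(**
  Let H be a maximal subgroup on which psi vanishes, and M its orthogonal. Averaging over H
  shows that the Gauss sums of all c.psi, c prime to p, may be taken over M; by maximality
  psi vanishes on M only along H, which forces p psi = 0 on M for p odd and 8 psi = 0 for
  p = 2. The sum S(c) of exp(2 pi i c psi) over M satisfies |S(c)|^2 = p^m with m = e mod 2.

  For p odd, S(c) depends only on c modulo squares mod p. If g generates the units mod p,
  summing S(c) over all c gives (p-1)(S(1) + S(g)) = 2(p|H| - |M|); together with the absolute
  values this forces S(g) = (-1)^e S(1). As S(-1) is the conjugate of S(1), the latter is
  real or purely imaginary, whence its phase exists.

  For p = 2, S(c) = A + B w + C w^2 + D w^3 with integers A, B, C, D independent of c odd and
  w = exp(2 pi i c / 8). Comparing |S(1)|^2 and |S(3)|^2 gives A^2 + B^2 + C^2 + D^2 = 2^m and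
  AB + BC + CD = DA, and dividing by 2 repeatedly, S(c) = (w + w^-1)^m w^j for a fixed j.
  Finally w + w^-1 = 2 cos(pi c / 4) is the square root of 2 with sign (-1)^(ell_2(c)).
*)

(** * Rational representatives and torsion in Q/Z *)

Lemma toQZ_repr (q : QZ) : toQZ (repr q) = q.
Proof. exact: reprK. Qed.

Lemma toQZ_int (m : int) : toQZ m%:~R = 0.
Proof.
have e0 : toQZ 0 = 0 by apply: (addIr (toQZ 0)); rewrite -toQZD add0r add0r.
by rewrite -e0; apply/eqP; rewrite toQZ_eq subr0 intr_int.
Qed.

Lemma toQZN x : toQZ (- x) = - toQZ x.
Proof. by apply: (addIr (toQZ x)); rewrite -toQZD !addNr (toQZ_int 0). Qed.

Lemma toQZMn x n : toQZ (x *+ n) = toQZ x *+ n.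
Proof.
elim: n => [|n IH]; first exact: (toQZ_int 0).
by rewrite !mulrS toQZD IH.
Qed.

Lemma QZ_torsion (n : nat) (q : QZ) :
  (0 < n)%N -> q *+ n = 0 -> exists k : nat, q = toQZ (k%:R / n%:R).
Proof.
move=> n0; rewrite -{1}(toQZ_repr q) -toQZMn -(toQZ_int 0) => /eqP.
rewrite toQZ_eq subr0 => /intrP [m hm].
have nQ : n%:R != 0 :> rat by rewrite pnatr_eq0 -lt0n.
have rE : repr q = m%:~R / n%:R by rewrite -hm -[repr q *+ n]mulr_natr mulfK.
(* The numerator is reduced mod [n] to make it a natural number; this changes the fraction by an
   integer. *)
exists `|(m %% n)%Z|%N; rewrite -(toQZ_repr q) rE; apply/eqP.
rewrite toQZ_eq -mulrBl {1}(divz_eq m n) natr_absz ger0_norm ?modz_ge0 ?eqz_nat -?lt0n //.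
by rewrite intrD addrK intrM -pmulrn mulfK // intr_int.
Qed.

(** * The character exp(2 pi i q) of Q/Z *)

Section Exponential.
Variable R : realType.
Implicit Types q : QZ.

Lemma expi2piD (r s : R) : expi2pi (r + s) = expi2pi r * expi2pi s.
Proof.
rewrite /expi2pi mulrDr cosD sinD; apply/eqP; rewrite eq_complex /=.
by apply/andP; split => //; rewrite addrC.
Qed.

Lemma expi2piN (r : R) : expi2pi (- r) = (expi2pi r)^*.
Proof. by rewrite /expi2pi mulrN cosN sinN. Qed.

(** The fractional part [s] of [r] satisfies cos(2 pi s) = 1, so sin(pi s) = 0 by the double-angle
    formula, whereas sin(pi s) > 0 for 0 < s < 1. *)
Lemma expi2pi_eq1 (r : R) : expi2pi r = 1 -> exists m : int, r = m%:~R.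
Proof.
move=> h; exists (Num.floor r).
set s := r - (Num.floor r)%:~R.
have [s0 s1] : 0 <= s /\ s < 1.
  rewrite /s subr_ge0 ltrBlDl; split; first exact: floor_le_tmp.
  by move: (floorD1_gt r); rewrite intrD.
have hs : expi2pi s = 1 by rewrite -(expi2pi_int _ (Num.floor r)) subrK.
have [/eqP s00|sn0] := boolP (s == 0); first by apply/eqP; rewrite -subr_eq0 -/s s00.
have sgt : 0 < s by rewrite lt_def sn0.
case: hs => c _.
have : 0 < sin (trigo.pi * s) by rewrite sin_gt0_pi // mulr_gt0 ?pi_gt0 //= gtr_pMr ?pi_gt0.
have : sin (trigo.pi * s) = 0.
  apply/eqP; rewrite -sqrf_eq0 sin2cos2.
  move: c; rewrite mulrnAl cos_mulr2n => c; apply/eqP.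
  by move: c; rewrite mulr2n; lra.
by move=> ->; rewrite ltxx.
Qed.

Lemma expQZD q r : expQZ R (q + r) = expQZ R q * expQZ R r.
Proof.
by rewrite -{1}(toQZ_repr q) -{1}(toQZ_repr r) -toQZD expQZ_toQZ rmorphD expi2piD.
Qed.

Lemma expQZ0 : expQZ R 0 = 1.
Proof.
rewrite -(toQZ_int 0) expQZ_toQZ rmorph_int /= /expi2pi mulr0 cos0 sin0.
by [].
Qed.

Lemma expQZN q : expQZ R (- q) = (expQZ R q)^*.
Proof. by rewrite -{1}(toQZ_repr q) -toQZN expQZ_toQZ rmorphN expi2piN. Qed.

Lemma expQZMn q n : expQZ R (q *+ n) = expQZ R q ^+ n.
Proof.
elim: n => [|n IH]; first exact: expQZ0.
by rewrite mulrS expQZD IH exprS.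
Qed.

Lemma expQZ_mulJ q : expQZ R q * (expQZ R q)^* = 1.
Proof. by rewrite -expQZN -expQZD subrr expQZ0. Qed.

Lemma norm_expQZ q : `|expQZ R q| = 1.
Proof. by apply/eqP; rewrite -sqrp_eq1 ?normr_ge0 // sqr_normc expQZ_mulJ. Qed.

Lemma expQZ_eq1 q : (expQZ R q == 1) = (q == 0).
Proof.
apply/eqP/eqP => [|->]; last exact: expQZ0.
rewrite -{1}(toQZ_repr q) expQZ_toQZ => /expi2pi_eq1 [m].
rewrite -(ratr_int R m) => /fmorph_inj e; rewrite -(toQZ_repr q) e; exact: toQZ_int.
Qed.

Lemma expQZ_inj : injective (expQZ R).
Proof.
move=> q r e; apply/eqP; rewrite -subr_eq0 -expQZ_eq1 expQZD expQZN e.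
by rewrite expQZ_mulJ.
Qed.

Lemma expQZ_half : expQZ R (toQZ (1 / 2%:R)) = -1.
Proof.
have h : 1 / 2%:R *+ 2 = 1%:~R :> rat by rewrite -[LHS]mulr_natr divfK.
set z := expQZ _ _.
have : z ^+ 2 = 1 by rewrite -expQZMn -toQZMn h toQZ_int expQZ0.
move/eqP; rewrite sqrf_eq1 => /orP [|/eqP //].
rewrite /z expQZ_eq1 -(toQZ_int 0) toQZ_eq subr0 => /intrP [m].
move/(congr1 (fun x => x * 2%:R)); rewrite divfK // -(intrM _ m 2%:Z) -[1]/(1%:~R) => /intr_inj.
by lia.
Qed.

End Exponential.

(** * Gauss sums over subgroups, and isotropic subgroups *)

Section QuadraticSums.
Variables (R : realType) (T : finZmodType).
Implicit Types (psi : T -> QZ) (H M : {set T}) (x y t : T).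

Definition orth psi H : {set T} := [set t | [forall s in H, polar psi t s == 0]].

Definition gauss_on M psi : R[i] := \sum_(t in M) expQZ R (psi t).

Lemma orthP psi H t :
  reflect (forall s, s \in H -> polar psi t s = 0) (t \in orth psi H).
Proof.
rewrite inE; apply: (iffP forall_inP) => h s sH; first exact/eqP/h.
exact/eqP/h.
Qed.

Lemma perp_orth psi : perp psi = orth psi [set: T]%SET.
Proof.
apply/setP => t; rewrite !inE; apply: eq_forallb => s.
by rewrite inE.
Qed.

Lemma gauss_setT psi : gauss R psi = gauss_on [set: T]%SET psi.
Proof. by apply: eq_bigl => t; rewrite inE. Qed.

Lemma sum_translate (V : nmodType) M (F : T -> V) u :
  zmod_closed M -> u \in M -> \sum_(t in M) F (t + u) = \sum_(t in M) F t.
Proof.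
move=> [M0 MB] uM.
have MN v : v \in M -> - v \in M by move=> vM; rewrite -sub0r; apply: MB.
rewrite [RHS](reindex_inj (addIr u)); apply: eq_bigl => t.
apply/idP/idP => h; last by rewrite -(addrK u t); apply: MB.
by rewrite -(opprK u); apply: MB => //; apply: MN.
Qed.

(** Orthogonality of characters: if [f u] is nonzero for some [u] in [H], translation by [u]
    multiplies the sum by [expQZ R (f u)], which differs from 1. *)
Lemma sum_char H (f : T -> QZ) :
  zmod_closed H -> {morph f : x y / x + y} ->
  \sum_(h in H) expQZ R (f h) = if [forall h in H, f h == 0] then #|H|%:R else 0.
Proof.
move=> Hz fD; case: ifPn => [/forall_inP f0|].
  rewrite (eq_bigr (fun => 1)) ?sumr_const // => h /f0/eqP ->; exact: expQZ0.
rewrite negb_forall => /existsP [u]; rewrite negb_imply => /andP [uH fu].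
have : (1 - expQZ R (f u)) * \sum_(h in H) expQZ R (f h) = 0.
  rewrite mulrBl mul1r mulr_sumr -{1}(sum_translate _ Hz uH) -sumrB big1 // => h _.
  by rewrite fD expQZD mulrC subrr.
move/eqP; rewrite mulf_eq0 subr_eq0 eq_sym expQZ_eq1 (negPf fu) /=.
by move/eqP.
Qed.

Lemma polarC psi x y : polar psi x y = polar psi y x.
Proof. by rewrite /polar (addrC x) addrAC. Qed.

Section Quadratic.
Variable psi : T -> QZ.
Hypothesis qpsi : quadratic psi.

Lemma polarDl x y z : polar psi (x + y) z = polar psi x z + polar psi y z.
Proof. exact: qpsi.2.1. Qed.

Lemma polarDr x y z : polar psi x (y + z) = polar psi x y + polar psi x z.
Proof. exact: qpsi.2.2. Qed.

Lemma quadD x y : psi (x + y) = psi x + psi y + polar psi x y.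
Proof. by rewrite [RHS]addrC /polar -[_ - _ - _]addrA -opprD subrK. Qed.

Lemma quadMz x (n : int) : psi (x *~ n) = psi x *~ (n ^+ 2).
Proof. exact: qpsi.1. Qed.

Lemma quadMn x n : psi (x *+ n) = psi x *+ (n ^ 2).
Proof. by rewrite pmulrn quadMz -rmorphXn -pmulrn. Qed.

Lemma quad0 : psi 0 = 0.
Proof. by rewrite -(mulr0n (0 : T)) quadMn. Qed.

Lemma polar0l y : polar psi 0 y = 0.
Proof. by rewrite /polar add0r quad0 subr0 subrr. Qed.

Lemma polarNl x y : polar psi (- x) y = - polar psi x y.
Proof. by apply: (addIr (polar psi x y)); rewrite -polarDl !addNr polar0l. Qed.

Lemma polarMnl x y n : polar psi (x *+ n) y = polar psi x y *+ n.
Proof. by elim: n => [|n IH]; rewrite ?polar0l // !mulrS polarDl IH. Qed.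

Lemma polarMzl x y (n : int) : polar psi (x *~ n) y = polar psi x y *~ n.
Proof. by case: n => n; rewrite ?NegzE ?mulrNz ?polarNl polarMnl. Qed.

Lemma polar_diag x : polar psi x x = psi x *+ 2.
Proof. by rewrite /polar -[x + x]mulr2n quadMn (mulrnDr _ 2 2) !mulr2n !addrA !addrK. Qed.

Lemma orth_zmod H : zmod_closed (orth psi H).
Proof.
split=> [|x y /orthP hx /orthP hy]; apply/orthP => s sH; first exact: polar0l.
by rewrite polarDl polarNl hx // hy // subrr.
Qed.

(** Substituting t = u + s in the double sum over t and s leaves, for each u, a character sum of
    b(u, s) over s in [M]; it vanishes unless u is orthogonal to [M], and then psi(u) = 0 by
    hypothesis. *)
Lemma gauss_on_normsq M :
  zmod_closed M -> {in M :&: orth psi M, forall x, psi x = 0} ->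
  `|gauss_on M psi| ^+ 2 = (#|M| * #|M :&: orth psi M|)%:R.
Proof.
move=> Mz rad0; rewrite sqr_normc /gauss_on rmorph_sum mulr_sumr.
transitivity (\sum_(s in M) \sum_(u in M) expQZ R (psi u) * expQZ R (polar psi u s)).
  apply: eq_bigr => s sM; rewrite mulr_suml -(sum_translate _ Mz sM).
  apply: eq_bigr => u uM; rewrite quadD (expQZD _ (_ + _)) (expQZD _ (psi u)) -!mulrA; congr (_ * _).
  by rewrite mulrCA expQZ_mulJ mulr1.
rewrite exchange_big /= (bigID [in orth psi M]) /= [X in _ + X]big1 ?addr0.
  rewrite natrM mulrC mulr_natl -sumr_const; apply: eq_big => [u|u /andP[uM uo]].
    by rewrite finset.in_setI.
  rewrite -mulr_sumr rad0 ?finset.in_setI ?uM // expQZ0 mul1r (eq_bigr (fun => 1)) ?sumr_const //.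
  by move=> s /(orthP _ _ _ uo) ->; exact: expQZ0.
move=> u /andP [uM]; rewrite inE => uo.
rewrite -mulr_sumr sum_char ?(negPf uo) ?mulr0 // => x y; exact: polarDr.
Qed.

(** For h in [H] one has psi(t + h) = psi(t) + b(t, h); summing over h kills every t not orthogonal
    to [H]. *)
Lemma gauss_isotropic H :
  zmod_closed H -> {in H, forall x, psi x = 0} ->
  gauss R psi = gauss_on (orth psi H) psi.
Proof.
move=> Hz H0; have cH : #|H|%:R != 0 :> R[i].
  rewrite pnatr_eq0 -lt0n; apply/card_gt0P; exists 0; exact: Hz.1.
apply: (mulfI cH); rewrite mulr_natl -sumr_const.
transitivity (\sum_(t : T) expQZ R (psi t) * \sum_(h in H) expQZ R (polar psi t h)).
  under [RHS]eq_bigr do rewrite mulr_sumr.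
  rewrite [RHS]exchange_big /=; apply: eq_bigr => h hH.
  rewrite /gauss (reindex_inj (addIr h)). apply: eq_bigr => t _.
  by rewrite quadD (H0 h hH) addr0 expQZD.
rewrite /gauss_on mulr_sumr (bigID [in orth psi H]) /= [X in _ + X]big1 ?addr0.
  apply: eq_bigr => t /orthP to; rewrite mulrC; congr (_ * _).
  rewrite (eq_bigr (fun => 1)) ?sumr_const // => s /to ->; exact: expQZ0.
move=> t; rewrite inE => to.
rewrite sum_char ?(negPf to) ?mulr0 // => x y; exact: polarDr.
Qed.

Lemma max_isotropic :
  exists H, [/\ zmod_closed H, {in H, forall x, psi x = 0}
    & {in orth psi H, forall x, psi x = 0 -> x \in H}].
Proof.
pose P H := `[< zmod_closed H /\ {in H, forall x, psi x = 0} >].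
have P0 : P [set 0].
  apply/asboolP; split; last by move=> x; rewrite inE => /eqP ->; exact: quad0.
  split=> [|x y]; first by rewrite inE.
  by rewrite !inE => /eqP -> /eqP ->; rewrite subr0.
case: (@arg_maxnP _ _ P (fun H => #|H|) P0) => H /asboolP [[H0 HB] Hpsi] Hmax.
exists H; split=> // x /orthP xo x0.
(* [K] is the subgroup H + Zx. It is isotropic since psi(h + n x) = psi(h) + n^2 psi(x) + n b(h, x),
   so H = K by maximality. *)
pose K := [set y | `[< exists h, exists n : int, h \in H /\ y = h + x *~ n >]].
have KP : P K.
  apply/asboolP; split; first split.
  - by rewrite !inE; exists 0, 0; rewrite mulr0z addr0.
  - move=> y z; rewrite !inE => -[h [n [hH ->]]] [k [m [kH ->]]].
    exists (h - k), (n - m); split; first exact: HB.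
    by rewrite mulrzBr opprD addrACA.
  - move=> y; rewrite !inE => -[h [n [hH ->]]].
    by rewrite quadD (Hpsi h hH) quadMz x0 mul0rz polarC polarMzl xo // mul0rz !addr0.
have sHK : H \subset K.
  apply/fintype.subsetP => h hH; rewrite !inE.
  by exists h, 0; rewrite mulr0z addr0.
have /eqP -> : H == K by rewrite eqEcard sHK; exact: Hmax.
by rewrite !inE; exists 0, 1; rewrite add0r mulr1z.
Qed.

Lemma isotropic_sub_orth H :
  zmod_closed H -> {in H, forall x, psi x = 0} -> H \subset orth psi H.
Proof.
move=> [H0 HB] Hpsi; apply/fintype.subsetP => x xH; apply/orthP => y yH.
have yN : - y \in H by rewrite -sub0r; apply: HB.
by rewrite /polar !Hpsi // ?subr0 // -(opprK y); apply: HB.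
Qed.

Lemma polar_scale (c : int) x y : polar (scale_quad c psi) x y = polar psi x y *~ c.
Proof. by rewrite /polar /scale_quad !mulrzBl. Qed.

Lemma scale_quadratic (c : int) : quadratic (scale_quad c psi).
Proof.
split=> [a x|]; first by rewrite /scale_quad quadMz -!mulrzA mulrC.
by split=> x y z; rewrite !polar_scale ?polarDl ?polarDr mulrzDl.
Qed.

End Quadratic.
End QuadraticSums.

(** * Reduction to an anisotropic situation on p-groups *)

Lemma zmod_closed_mulz (V : finZmodType) (M : {set V}) (x : V) (n : int) :
  zmod_closed M -> x \in M -> x *~ n \in M.
Proof.
move=> [M0 MB] xM.
have MN v : v \in M -> - v \in M by move=> vM; rewrite -sub0r; apply: MB.
have Mn m : x *+ m \in M.
  elim: m => [|m IH] //; rewrite mulrS -(opprK (x *+ m)).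
  by apply: MB => //; apply: MN.
by case: n => n; rewrite ?NegzE ?mulrNz ?MN ?Mn.
Qed.

Lemma coprime_cancel (V : zmodType) (p n : nat) (c : int) (q : V) :
  coprimez c p%:Z -> q *+ (p ^ n) = 0 -> q *~ c = 0 -> q = 0.
Proof.
move=> cop qp qc.
have /coprimezP [[u v] /= e] : coprimez c (p ^ n)%N%:Z.
  by move: cop; rewrite /coprimez /gcdz !eqz_nat => /(coprimeXr n).
rewrite -[q]mulr1z -e mulrzDr (mulrC u) (mulrC v) !mulrzA qc.
by rewrite -[q *~ Posz _]/(q *+ _) qp !mul0rz addr0.
Qed.

Lemma finZmod_mulr_card (V : finZmodType) (x : V) : x *+ #|V| = 0.
Proof.
by have := expg_cardG (finset.in_setT x : x \in [set: V]%G); rewrite FinRing.zmodXgE cardsT FinRing.zmod1gE.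
Qed.

Section PrimePower.
Variables (p : nat) (T : finZmodType) (psi : T -> QZ).
Hypotheses (p_pr : prime p) (pT : (p.-group [set: T])%g) (qpsi : quadratic psi).

Lemma card_ppower : exists k, #|T| = (p ^ k)%N.
Proof. by have /p_natP [k] := pT; rewrite cardsT => e; exists k. Qed.

Lemma polar_ppower : exists k, forall x y, polar psi x y *+ (p ^ k) = 0.
Proof.
have [k e] := card_ppower; exists k => x y.
by rewrite -polarMnl // -e finZmod_mulr_card polar0l.
Qed.

Lemma quad_ppower : exists k, forall x, psi x *+ (p ^ k) = 0.
Proof.
have [k e] := card_ppower; exists (k * 2)%N => x.
by rewrite expnM -quadMn // -e finZmod_mulr_card quad0.
Qed.

(** The values of b are killed by a power of p, so a factor [c] prime to p can be cancelled. *)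
Lemma orth_scale (c : int) (H : {set T}) :
  coprimez c p%:Z -> orth (scale_quad c psi) H = orth psi H.
Proof.
move=> cop; have [k pk] := polar_ppower.
apply/setP => x; apply/orthP/orthP => h s sH; last by rewrite polar_scale h ?mul0rz.
by apply: (coprime_cancel cop (pk x s)); rewrite -polar_scale h.
Qed.

Lemma tame_scale (c : int) : coprimez c p%:Z -> tame psi -> tame (scale_quad c psi).
Proof.
move=> cop tpsi x; rewrite perp_orth orth_scale // -perp_orth => /tpsi.
by rewrite /scale_quad => ->; rewrite mul0rz.
Qed.

(** The norm formula with M = T gives |T| |T^perp| = p^e |T^perp|^2, and T^perp has order p^f. What
    matters below is that the exponent has the parity of [e]. *)
Lemma gauss_normsq (R : realType) (e : nat) :
  tame psi -> #|([set: T] / perp psi)%g| = (p ^ e)%N ->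
  exists f, forall c : int, coprimez c p%:Z ->
    `|gauss R (scale_quad c psi)| ^+ 2 = (p ^ (e + f.*2))%:R.
Proof.
move=> tpsi he; have [P0 PB] := orth_zmod qpsi [set: T]%SET.
have PN v : v \in perp psi -> - v \in perp psi.
  by rewrite perp_orth => vP; rewrite -sub0r; apply: PB.
have gP : group_set (perp psi).
  apply/group_setP; split=> [|x y xP yP]; first by rewrite perp_orth; exact: P0.
  by rewrite FinRing.zmodMgE -(opprK y) {1}perp_orth; apply: PB; rewrite -perp_orth ?PN.
have := Lagrange (finset.subsetT (Group gP)).
have Tz : zmod_closed [set: T]%SET by split=> [|x y]; rewrite !inE.
rewrite -card_quotient; last by rewrite sub_abelian_norm ?FinRing.zmod_abelian ?finset.subsetT.
rewrite /= he => eT.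
have : (#|perp psi| %| p ^ logn p #|T|)%N.
  have [k e'] := card_ppower; rewrite e' pfactorK // -e' -cardsT -eT dvdn_mulr //.
case/(dvdn_pfactor _ _ p_pr) => f _ ef; exists f => c cop.
rewrite gauss_setT gauss_on_normsq //; last 2 first.
- exact: scale_quadratic.
- by move=> x; rewrite finset.setTI -perp_orth => /(tame_scale cop tpsi).
rewrite finset.setTI orth_scale // -perp_orth -eT ef -!expnD.
by congr (_ ^ _)%:R; lia.
Qed.

(** [M] is the orthogonal of a maximal isotropic [H]. One pair serves every [c] prime to p, because
    [H] stays isotropic for c.psi and, by [orth_scale], keeps its orthogonal. *)
Lemma gauss_reduction : exists M H : {set T},
  [/\ zmod_closed M, H \subset M, {in M, forall x, (psi x == 0) = (x \in H)},
      {in M & H, forall x h, polar psi x h = 0}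
    & forall (R : realType) (c : int), coprimez c p%:Z ->
        gauss R (scale_quad c psi) = gauss_on R M (scale_quad c psi)].
Proof.
have [H [Hz H0 Hmax]] := max_isotropic qpsi.
exists (orth psi H), H; split.
- exact: orth_zmod.
- exact: isotropic_sub_orth.
- by move=> x xM; apply/eqP/idP => [/(Hmax x xM)|/H0].
- by move=> x h /orthP xM hH; apply: xM.
move=> R c cop; rewrite (gauss_isotropic R (scale_quadratic qpsi c) Hz) ?orth_scale //.
by move=> x xH; rewrite /scale_quad H0 ?mul0rz.
Qed.

Section Anisotropic.
Variables M H : {set T}.
Hypotheses (Mz : zmod_closed M)
  (MH : {in M, forall x, (psi x == 0) = (x \in H)})
  (HM : {in M & H, forall x h, polar psi x h = 0}).

(** If n^2 psi(x) = 0 then psi(n x) = 0, so n x lies in [H] and b(n x, x) = 2n psi(x) vanishes. *)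
Lemma anisotropic_step x n :
  x \in M -> psi x *+ (n ^ 2) = 0 -> psi x *+ (2 * n) = 0.
Proof.
move=> xM e; have yM : x *+ n \in M by apply: (zmod_closed_mulz n).
have := HM xM (_ : x *+ n \in H).
rewrite polarC polarMnl // polar_diag // -mulrnA; apply.
by rewrite -MH // quadMn // e.
Qed.

Lemma anisotropic_odd : odd p -> {in M, forall x, psi x *+ p = 0}.
Proof.
move=> p_odd x xM; have [k pk] := quad_ppower.
have {pk} : psi x *+ (p ^ k.+1) = 0 by rewrite expnSr mulrnA pk mul0rn.
elim: k => [|k IH]; first by rewrite expn1.
(* From p^(k+2) to p^(k+1): n = p^(k+1) is admissible because 2(k+1) >= k+2, and the factor 2 that
   it leaves is prime to p. *)
move=> e; apply: IH; have /(anisotropic_step xM) e2 : psi x *+ ((p ^ k.+1) ^ 2) = 0.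
  have -> : ((p ^ k.+1) ^ 2 = p ^ k.+2 * p ^ k)%N.
    by rewrite -expnM -expnD muln2 -addnn addnS.
  by rewrite mulrnA e mul0rn.
apply: (@coprime_cancel _ p 1 2 _).
- by rewrite /coprimez /gcdz eqz_nat -[_ == _]/(coprime 2 p) coprime2n.
- by rewrite expn1 -mulrnA -expnSr e.
by rewrite -[LHS]mulrnA mulnC e2.
Qed.

Lemma anisotropic_two : p = 2%N -> {in M, forall x, psi x *+ 8 = 0}.
Proof.
move=> p2 x xM; have [k] := quad_ppower; move=> /(_ x); rewrite p2 => pk.
have {pk} : psi x *+ (2 ^ (k + 3)) = 0 by rewrite expnD mulrnA pk mul0rn.
elim: k => [|k IH] // e; apply: IH.
(* With n = 2^(k+2) one passes from 2^(k+4) to 2n = 2^(k+3). The descent stops at 8: for n = 2, n^2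
   = 4 is not a multiple of 8. *)
have /(anisotropic_step xM) : psi x *+ ((2 ^ (k + 2)) ^ 2) = 0.
  have -> : ((2 ^ (k + 2)) ^ 2 = 2 ^ (k.+1 + 3) * 2 ^ k)%N.
    by rewrite -expnM -expnD; congr (_ ^ _)%N; lia.
  by rewrite mulrnA e mul0rn.
by rewrite -expnS -addnS.
Qed.

End Anisotropic.
End PrimePower.

(** * Odd p: Gauss sums over [M] as functions of the residue class of c *)

Lemma sum_expQZ_torsion (R : realType) (n : nat) (q : QZ) :
  q *+ n = 0 -> \sum_(i < n) expQZ R (q *+ i) = if q == 0 then n%:R else 0.
Proof.
move=> qn; case: eqP => [->|/eqP q0].
  rewrite (eq_bigr (fun => 1)) ?sumr_const ?card_ord // => i _.
  by rewrite mul0rn expQZ0.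
have := subrX1 (expQZ R q) n; rewrite -expQZMn qn expQZ0 subrr => /esym/eqP.
rewrite mulf_eq0 subr_eq0 expQZ_eq1 (negPf q0) /= => /eqP h; rewrite -[RHS]h.
by apply: eq_bigr => i _; rewrite expQZMn.
Qed.

Lemma exists_primitive_residue (p : nat) : prime p ->
  exists g : nat, coprime g p /\
    forall n : nat, coprime n p -> exists i, n = g ^ i %[mod p].
Proof.
move=> p_pr; have pE := pdiv_id p_pr; have p1 := prime_gt1 p_pr.
have fermat (x : 'F_p) : x != 0 -> x ^+ p.-1 = 1.
  move=> x0; apply: (mulfI x0); rewrite mulr1 -exprS prednK ?prime_gt0 //.
  by have := expf_card x; rewrite card_Fp.
have eqF m n : (m%:R == n%:R :> 'F_p) = (m == n %[mod p]).
  by rewrite -val_eqE /= !val_Fp_nat.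
have unitF n : (n%:R != 0 :> 'F_p) = coprime n p.
  by rewrite coprime_sym prime_coprime // (eqF n 0%N) mod0n.
have : has (p.-1).-primitive_root (enum (predC1 (0 : 'F_p))).
  apply: has_prim_root; rewrite ?enum_uniq //; first by rewrite -ltnS prednK // ltnW.
    apply/allP => x; rewrite mem_enum => x0; apply/unity_rootP; exact: fermat.
  by rewrite -cardE cardC1 card_Fp.
case/hasP => g; rewrite mem_enum => g0 gprim; exists (val g); split.
  by rewrite -unitF natr_Zp.
move=> n; rewrite -unitF => /fermat /(prim_rootP gprim) [i ei].
by exists i; apply/eqP; rewrite -eqF natrX natr_Zp ei.
Qed.

Section OddPrime.
Variables (R : realType) (p : nat) (T : finZmodType) (psi : T -> QZ).
Hypotheses (p_pr : prime p) (p_odd : odd p) (pT : (p.-group [set: T])%g).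
Hypothesis qpsi : quadratic psi.
Variables M H : {set T}.
Hypotheses (Mz : zmod_closed M) (sHM : H \subset M)
  (MH : {in M, forall x, (psi x == 0) = (x \in H)})
  (HM : {in M & H, forall x h, polar psi x h = 0})
  (Mp : {in M, forall x, psi x *+ p = 0}).

Let S (c : int) : R[i] := gauss_on R M (scale_quad c psi).

Lemma gauss_on_mod (c d : int) : (c = d %[mod p])%Z -> S c = S d.
Proof.
move=> e; apply: eq_bigr => x xM; congr (expQZ _ _); rewrite /scale_quad.
have h b : psi x *~ b = psi x *~ (b %% p)%Z.
  rewrite {1}(divz_eq b p) mulrzDr mulrC mulrzA.
  by rewrite -[psi x *~ p]/(psi x *+ p) Mp // mul0rz add0r.
by rewrite h e -h.
Qed.

(** The map x -> c x permutes [M] and multiplies psi by c^2. *)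
Lemma gauss_on_sq (c d : int) : coprimez c p -> S (c ^+ 2 * d) = S d.
Proof.
move=> cop; have [k ek] := card_ppower pT.
have inj : injective (fun x : T => x *~ c).
  move=> x y /eqP; rewrite -subr_eq0 -mulrzBl => /eqP e.
  apply/eqP; rewrite -subr_eq0; apply/eqP.
  apply: (@coprime_cancel _ p k c _ cop _ e); rewrite -ek; exact: finZmod_mulr_card.
rewrite /S /gauss_on.
have imM : [set x *~ c | x in M] = M.
  apply/eqP; rewrite eqEcard card_imset // leqnn andbT.
  apply/fintype.subsetP => _ /imsetP [x xM ->]; exact: zmod_closed_mulz.
rewrite -{2}imM big_imset /=; last by move=> x y _ _; apply: inj.
by apply: eq_bigr => x _; rewrite /scale_quad quadMz // mulrzA.
Qed.

Lemma gauss_onN (c : int) : S (- c) = (S c)^*.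
Proof.
rewrite /S /gauss_on rmorph_sum; apply: eq_bigr => x _.
by rewrite /scale_quad mulrNz expQZN.
Qed.

Lemma gauss_on_norm (c : int) : coprimez c p -> `|S c| ^+ 2 = (#|M| * #|H|)%:R.
Proof.
move=> cop.
(* The radical of b on [M] lies in [H]: b(x, x) = 2 psi(x), and 2 is invertible mod p. *)
have rad : {in M, forall x, x \in orth psi M -> x \in H}.
  move=> x xM /orthP /(_ x xM); rewrite polar_diag // => e2; rewrite -MH //.
  apply/eqP; apply: (@coprime_cancel _ p 1 2 _); last exact: e2.
    by rewrite /coprimez /gcdz eqz_nat -[_ == _]/(coprime 2 p) coprime2n.
  by rewrite expn1 Mp.
rewrite /S gauss_on_normsq ?(orth_scale pT qpsi) //; first last.
- move=> x; rewrite finset.in_setI => /andP [xM /(rad _ xM)].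
  by rewrite -MH // /scale_quad => /eqP ->; rewrite mul0rz.
- exact: scale_quadratic.
congr (_ * _)%:R; apply: eq_card => x; rewrite finset.in_setI.
apply/andP/idP => [[xM]|xH]; first exact: rad.
have xM := fintype.subsetP sHM x xH; split=> //.
by apply/orthP => s sM; rewrite polarC HM.
Qed.

(** For fixed x the sum over i is a geometric sum of p-th roots of unity: p if psi(x) = 0, that is
    if x is in [H], and 0 otherwise. *)
Lemma sum_gauss_on (c : int) :
  coprimez c p -> \sum_(i < p) S (c * i%:Z) = (p * #|H|)%:R.
Proof.
move=> cop; rewrite /S /gauss_on exchange_big /=.
transitivity (\sum_(x in M) if x \in H then p%:R else 0 : R[i]).
  apply: eq_bigr => x xM; rewrite /scale_quad.
  have -> : (x \in H) = (psi x *~ c == 0).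
    rewrite -MH //; apply/eqP/eqP => [->|]; first by rewrite mul0rz.
    by apply: (@coprime_cancel _ p 1) => //; rewrite expn1 Mp.
  rewrite -sum_expQZ_torsion; last by rewrite pmulrn mulrzAC -pmulrn Mp // mul0rz.
  by apply: eq_bigr => i _; rewrite mulrzA.
rewrite -big_mkcondr /= (eq_bigl (mem H)); last first.
  move=> x /=; apply: andb_idl; exact: (fintype.subsetP sHM).
by rewrite sumr_const -[LHS]mulr_natr -natrM.
Qed.

Lemma gauss_on_generator (g n : nat) (c : int) : coprime g p ->
   (c = (g ^ n)%N %[mod p])%Z -> S c = S (if odd n then g%:Z else 1).
Proof.
move=> cop /gauss_on_mod ->.
have -> : (g ^ n)%N%:Z = ((g ^ n./2)%N%:Z) ^+ 2 * (if odd n then g%:Z else 1).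
  rewrite -{1}(odd_double_half n) expnD -muln2 expnM PoszM mulrC expr2 -PoszM mulnn.
  by case: (odd n); rewrite ?expn1 ?expn0.
by rewrite gauss_on_sq // /coprimez /gcdz eqz_nat; apply: coprimeXl.
Qed.

(** For i nonzero mod p, i and g i have discrete logarithms of opposite parity, so S(i) + S(g i) =
    S(1) + S(g). The term i = 0 contributes 2|M|, and [sum_gauss_on] gives the total. *)
Lemma gauss_on_pair (g : nat) : coprime g p ->
  (forall n : nat, coprime n p -> exists i, n = g ^ i %[mod p]) ->
  p.-1%:R * (S 1 + S g) = 2 * (p%:R * #|H|%:R - #|M|%:R).
Proof.
move=> cop gen; have p0 := prime_gt0 p_pr.
have S0 : S 0 = #|M|%:R.
  rewrite /S /gauss_on (eq_bigr (fun => 1)) ?sumr_const // => x _; exact: expQZ0.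
have : \sum_(i < p) (S (1 * i%:Z) + S (g%:Z * i%:Z)) = 2 * (p%:R * #|H|%:R).
  rewrite big_split /= !sum_gauss_on //; last by rewrite /coprimez /gcdz /= gcd1n.
  by rewrite natrM mulr2n mulrDl !mul1r.
rewrite (bigD1 (Ordinal p0)) //= !mulr0 S0 (eq_bigr (fun => S 1 + S g)).
  rewrite sumr_const cardC1 card_ord -mulr_natl => e; rewrite mulrBr -e; ring.
move=> i i0; have copi : coprime i p.
  rewrite coprime_sym prime_coprime // gtnNdvd //.
  by rewrite lt0n; apply: contra i0 => /eqP e; apply/eqP/val_inj.
have [n en] := gen i copi; rewrite mul1r.
have enz k m' : (k = m' %[mod p])%N -> (k = m' %[mod p])%Z.
  by move=> e; rewrite !modz_nat e.
rewrite (gauss_on_generator cop (enz _ _ en)) (@gauss_on_generator g n.+1 (g%:Z * i%:Z)) //=.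
  by case: (odd n) => //=; rewrite addrC.
by rewrite -PoszM; apply: enz; rewrite expnS -modnMmr en modnMmr.
Qed.

Lemma ell_odd (a : int) : coprimez a p ->
  forall g : nat, coprime g p ->
  (forall n : nat, coprime n p -> exists i, n = g ^ i %[mod p]) ->
  S a = if ell p a == 0%N then S 1 else S g.
Proof.
move=> copa g cop gen.
have p2 : (p == 2%N) = false by apply/eqP => e; move: p_odd; rewrite e.
rewrite /ell p2; case: existsP => /= [[x /eqP ex]|nex].
  rewrite -(gauss_on_mod ex) -[_ ^+ 2]mulr1 gauss_on_sq //.
  have : coprimez (x%:Z ^+ 2) p.
    by rewrite /coprimez -gcdz_modl ex gcdz_modl.
  by rewrite /coprimez /gcdz abszX !eqz_nat -[_ == _]/(coprime _ _) coprime_pexpl.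
have p0 : p%:Z != 0 by rewrite eqz_nat -lt0n prime_gt0.
pose n := `|(a %% p)%Z|%N.
have an : (a = n%:Z %[mod p])%Z by rewrite /n gez0_abs ?modz_ge0 // modz_mod.
have copn : coprime n p.
  have : coprimez n%:Z p by rewrite /coprimez -gcdz_modl -an gcdz_modl.
  by rewrite /coprimez /gcdz eqz_nat.
have [i ei] := gen n copn.
have ai : (a = (g ^ i)%N %[mod p])%Z by rewrite an !modz_nat ei.
(* An even exponent would make [a] the square of g^(i/2) mod p. *)
rewrite (gauss_on_generator cop ai); case: ifPn => // oi; exfalso; apply: nex.
exists (Ordinal (ltn_pmod (g ^ i./2) (prime_gt0 p_pr))) => /=; rewrite ai; apply/eqP.
rewrite -modz_nat modzXm -[in RHS](odd_double_half i) (negPf oi) add0n -muln2 expnM.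
by rewrite -mulnn PoszM -expr2.
Qed.

End OddPrime.

(* By the parallelogram law, [(p-1)^2 |s - t|^2 = 4 p^(2n) (p^d - 1)(p^2 - p^d)]; this is
   negative for [d >= 3], and zero for [d = 0, 2]. *)
Lemma gauss_pair_sign (R : realType) (p n d : nat) (s t : R[i]) :
  (1 < p)%N -> `|s| ^+ 2 = (p ^ (n + n + d))%:R -> `|t| ^+ 2 = (p ^ (n + n + d))%:R ->
  p.-1%:R * (s + t) = 2 * (p%:R * (p ^ n)%:R - (p ^ (n + d))%:R) ->
  t = (-1) ^+ d * s.
Proof.
move=> p1 hs ht hst.
have p0 : p.-1%:R != 0 :> R[i] by rewrite pnatr_eq0 -lt0n -ltnS prednK // ltnW.
(* For [d = 1] the right-hand side of the relation vanishes, so t = -s. *)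
have [d1|d1] := eqVneq d 1%N.
  move: hst; rewrite d1 addn1 expnS natrM subrr mulr0 => /eqP.
  by rewrite mulf_eq0 (negPf p0) addrC addr_eq0 expr1 mulN1r => /eqP.
pose P : int := p.
(* [D] is the integer equal to (p-1)^2 |s - t|^2; its nonnegativity restricts [d]. *)
pose D : int := 4 * (P ^+ n) ^+ 2 * ((P ^+ d - 1) * (P ^+ 2 - P ^+ d)).
have eD : (p.-1%:R * `|s - t|) ^+ 2 = D%:~R :> R[i].
  have par : `|s - t| ^+ 2 = 2 * (`|s| ^+ 2 + `|t| ^+ 2) - `|s + t| ^+ 2.
    by rewrite !sqr_normc rmorphB rmorphD; ring.
  have e1 : p.-1%:R ^+ 2 * `|s + t| ^+ 2 = (2 * (p%:R * (p ^ n)%:R - (p ^ (n + d))%:R)) ^+ 2.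
    rewrite -[in LHS](normr_nat _ p.-1) -exprMn -normrM hst.
    set r : R[i] := 2 * _; have -> : r = (2 * (P * P ^+ n - P ^+ (n + d)))%:~R.
      by rewrite /r /P !(intrM, intrD, rmorphN, rmorphXn).
    by rewrite real_normK // realz.
  rewrite exprMn par [LHS]mulrBr e1 hs ht /D /P.
  have -> : p.-1%:R = p%:R - 1 :> R[i] by rewrite -subn1 natrB // ltnW.
  by rewrite !(intrM, intrD, rmorphN, rmorphXn) /= !exprD; ring.
have D0 : 0 <= D by rewrite -(ler0z R[i]) -eD exprn_ge0 // mulr_ge0 // ler0n.
have P0 : 0 < P by rewrite ltz_nat ltnW.
have d02 : d = 0%N \/ d = 2%N.
  case: d d1 @D eD D0 {hs ht hst} => [|[|[|d]]] // _; [by left | by right | ].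
  move=> D _; rewrite /D pmulr_rge0; last by rewrite mulr_gt0 // exprn_gt0 // exprn_gt0.
  rewrite pmulr_rge0; last by rewrite subr_gt0 exprn_egt1.
  by rewrite subr_ge0 ler_eXn2l.
have : D = 0 by rewrite /D; case: d02 => ->; ring.
move=> D00; move: eD; rewrite D00 => /eqP.
rewrite sqrf_eq0 mulf_eq0 (negPf p0) normr_eq0 subr_eq0 => /eqP ->.
by case: d02 => ->; rewrite ?expr0 ?sqrrN ?expr1n mul1r.
Qed.

(** * Existence and uniqueness of phases, and the formula for odd p *)

Lemma phase_of_conj (R : realType) (z : R[i]) :
  z^* = z \/ z^* = - z -> exists b : QZ, z = `|z| * expQZ R b.
Proof.
have real w : w^* = w -> exists b : QZ, w = `|w| * expQZ R b :> R[i].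
  case: w => a b [] ?; have b0 : b = 0 by lra.
  have wr : (a +i* b)%C \is Num.real by rewrite complex_real b0.
  case: (real_ge0P wr) => w0; [exists 0 | exists (toQZ (1 / 2%:R))].
    by rewrite expQZ0 mulr1.
  by rewrite expQZ_half mulrN1 opprK.
case; first exact: real.
(* Multiplication by exp(2 pi i / 4) = i turns an imaginary [z] into a real number, which has phase
   0 or 1/2. *)
move=> zN; pose q := toQZ (1 / 4%:R).
have i2 : expQZ R q ^+ 2 = -1.
  rewrite -expQZMn -toQZMn -expQZ_half; congr (expQZ _ (toQZ _)); lra.
have ij : (expQZ R q)^* = - expQZ R q.
  by have := expQZ_mulJ R q; rewrite -[RHS]opprK -i2 expr2 -mulrN;
     apply: mulfI; rewrite -normr_eq0 norm_expQZ oner_eq0.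
have [b eb] : exists b : QZ, z * expQZ R q = `|z * expQZ R q| * expQZ R b.
  apply: real; transitivity (z^* * (expQZ R q)^*); first exact: rmorphM.
  by rewrite zN ij mulrNN.
exists (b - q); rewrite expQZD expQZN mulrA.
by rewrite normrM norm_expQZ mulr1 in eb; rewrite -eb -mulrA expQZ_mulJ mulr1.
Qed.

(** Injectivity of [expQZ] makes a phase unique, so the choice made by [xget] is immaterial. *)
Lemma is_phaseP (R : realType) (T : finZmodType) (psi : T -> QZ) (b : QZ) :
  is_phase R psi b -> phase R psi = b.
Proof.
move=> hb; rewrite /phase; case: xgetP => [c _ [] c0 ec|/(_ b)] //.
have [b0 eb] := hb.
apply: (@expQZ_inj R); have n0 : `|gauss R psi| != 0 by rewrite normr_eq0.
by apply: (mulfI n0); rewrite -ec -eb.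
Qed.

Lemma expQZ_halves (R : realType) (n : nat) : expQZ R (toQZ (n%:R / 2%:R)) = (-1) ^+ n.
Proof.
by rewrite mulrnAl toQZMn expQZMn expQZ_half.
Qed.

Lemma phase_odd (R : realType) (p : nat) (T : finZmodType) (psi : T -> QZ) (a : int) (e : nat) :
  prime p -> odd p -> (p.-group [set: T])%g -> quadratic psi -> tame psi ->
  coprimez a p%:Z -> #|([set: T] / perp psi)%g| = (p ^ e)%N ->
  exists b, is_phase R psi b /\
    is_phase R (scale_quad a psi) (b + toQZ ((ell p a * e)%:R / 2%:R)).
Proof.
move=> p_pr p_odd pT qpsi tpsi copa he.
have [f hf] := gauss_normsq p_pr pT qpsi R tpsi he.
have [M [H [Mz sHM MH HM hred]]] := gauss_reduction pT qpsi.
have Mp := anisotropic_odd pT qpsi Mz MH HM p_odd.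
have [g [copg gen]] := exists_primitive_residue p_pr.
have cop1 : coprimez 1 p%:Z by rewrite /coprimez /gcdz /= gcd1n.
have copN1 : coprimez (-1) p%:Z by rewrite /coprimez /gcdz /= gcd1n.
have copgz : coprimez g%:Z p%:Z by rewrite /coprimez /gcdz eqz_nat.
have normS c := gauss_on_norm R p_odd pT qpsi Mz sHM MH HM Mp (c := c).
(* Two evaluations of |S(1)|^2, over [M] and over [T], are compared; |M| and |H| are then powers of
   p. *)
have cardMH : (#|M| * #|H| = p ^ (e + f.*2))%N.
  by apply/eqP; rewrite -(eqr_nat R[i]) -(normS 1) // -hred // hf.
have [k _ ek] : exists2 k, (k <= e + f.*2)%N & #|M| = (p ^ k)%N.
  by apply/(dvdn_pfactor _ _ p_pr); rewrite -cardMH dvdn_mulr.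
have [n _ en] : exists2 n, (n <= e + f.*2)%N & #|H| = (p ^ n)%N.
  by apply/(dvdn_pfactor _ _ p_pr); rewrite -cardMH dvdn_mull.
have p1 := prime_gt1 p_pr.
have nk : (n <= k)%N by rewrite -(leq_exp2l _ _ p1) -en -ek subset_leq_card.
have ekn : (k + n = e + f.*2)%N.
  by apply/eqP; rewrite -(eqn_exp2l _ _ p1) expnD -ek -en cardMH.
have eMH : (#|M| * #|H| = p ^ (n + n + (k - n)))%N.
  by rewrite cardMH -ekn; congr (_ ^ _)%N; lia.
set S := fun c : int => gauss_on R M (scale_quad c psi) in normS.
have Sg : S g = (-1) ^+ e * S 1.
  (* k - n has the parity of k + n = e + 2f, hence of [e]. *)
  have -> : (-1) ^+ e = (-1) ^+ (k - n) :> R[i].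
    rewrite -signr_odd -[RHS]signr_odd oddB // addbC -oddD addnC ekn oddD odd_double addbF //.
  apply: (@gauss_pair_sign R p n) => //; rewrite -?eMH ?normS //.
  by rewrite subnKC // -en -ek; exact: (gauss_on_pair R p_pr pT qpsi Mz sHM MH Mp copg gen).
have Sc c : coprimez c p -> S c = (-1) ^+ (ell p c * e) * S 1.
  move=> cop; rewrite [LHS](ell_odd R p_pr p_odd pT qpsi Mz Mp cop copg gen).
  have : (ell p c <= 1)%N by rewrite /ell; case: ifP => _; case: (~~ _).
  by case: (ell p c) => [|[|]] // _; rewrite ?mul0n ?mul1r ?mul1n.
have g1 : gauss R psi = S 1 by exact: (hred R 1 cop1).
have ga : gauss R (scale_quad a psi) = S a by exact: hred.
have S10 : S 1 != 0.
  by rewrite -normr_eq0 -sqrf_eq0 normS // pnatr_eq0 -lt0n cardMH expn_gt0 prime_gt0.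
have [b eb] : exists b, S 1 = `|S 1| * expQZ R b.
  (* S(-1) is the conjugate of S(1) and also equals S(1) or -S(1). *)
  apply: phase_of_conj; rewrite -[(S 1)^*]gauss_onN -/(S (-1)) Sc // -signr_odd.
  by case: (odd _); rewrite ?mul1r ?mulN1r; [right | left].
exists b; split; first by rewrite /is_phase g1.
rewrite /is_phase ga Sc // mulf_neq0 ?signr_eq0 //; split=> //.
by rewrite expQZD expQZ_halves normrM normrX normrN1 expr1n mul1r mulrA -eb mulrC.
Qed.

(** * The norm equation in Z[zeta_8] *)

Lemma four_squares_even (A B C D : int) (n : nat) :
  A ^+ 2 + B ^+ 2 + C ^+ 2 + D ^+ 2 = 2 ^+ n.+2 -> A * B + B * C + C * D = D * A ->
  exists A' B' C' D' : int, [/\ A = 2 * A', B = 2 * B', C = 2 * C' & D = 2 * D'].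
Proof.
move=> hs hk.
have half (X : int) : exists X', X = 2 * X' \/ X = 2 * X' + 1.
  exists (X %/ 2)%Z; lia.
have [A' hA] := half A; have [B' hB] := half B.
have [C' hC] := half C; have [D' hD] := half D.
exists A', B', C', D'.
move: hs; rewrite !exprS mulrA; set N := 2 ^+ n; move: N => N hs.
rewrite expr0 !mulr1 in hs.
(* Modulo 4 the first relation gives all four the same parity; if all were odd, AB + BC + CD - DA
   would be 2 mod 4. *)
case: hA hB hC hD => -> [] -> [] -> [] -> in hs hk *; try (exfalso; lia).
by split.
Qed.

(* [w - w ^+ 3] is a square root of 2: the form is a norm equation in Z[zeta_8], where 2 is
   totally ramified, so that up to a root of unity the only solutions are its powers. *)
Lemma zeta8_norm_form (m : nat) (A B C D : int) :
  A ^+ 2 + B ^+ 2 + C ^+ 2 + D ^+ 2 = 2 ^+ m -> A * B + B * C + C * D = D * A ->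
  exists j : nat, forall (K : comNzRingType) (w : K), w ^+ 4 = -1 ->
    A%:~R + B%:~R * w + C%:~R * w ^+ 2 + D%:~R * w ^+ 3 = (w - w ^+ 3) ^+ m * w ^+ j.
Proof.
have small (X N : int) : 0 <= N -> N <= 2 -> X ^+ 2 <= N -> [\/ X = 0, X = 1 | X = -1].
  rewrite expr2 => N0 N2 hX.
  have [h|[h|h]] : X = 0 \/ X = 1 \/ X = -1 by nia.
  - by constructor 1. - by constructor 2. - by constructor 3.
have [n] := ubnP m; elim: n m A B C D => [|n IH] // [|[|m]] A B C D mn hs hk.
- have sA := sqr_ge0 A; have sB := sqr_ge0 B; have sC := sqr_ge0 C; have sD := sqr_ge0 D.
  rewrite expr0 in hs.
  have hA : [\/ A = 0, A = 1 | A = -1] by apply: (small _ 1) => //; lia.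
  have hB : [\/ B = 0, B = 1 | B = -1] by apply: (small _ 1) => //; lia.
  have hC : [\/ C = 0, C = 1 | C = -1] by apply: (small _ 1) => //; lia.
  have hD : [\/ D = 0, D = 1 | D = -1] by apply: (small _ 1) => //; lia.
  (* Exactly one coefficient is 1 or -1, so the sum is some w^k or -w^k = w^(k+4). *)
  pose j : nat := if A == 1 then 0%N else if B == 1 then 1%N else if C == 1 then 2%N
    else if D == 1 then 3%N else if A == -1 then 4%N else if B == -1 then 5%N
    else if C == -1 then 6%N else 7%N.
  exists j => K w w4; rewrite /j {j} expr0 mul1r.
  have w5 : w ^+ 5 = - w by rewrite exprS w4 mulrN1.
  have w6 : w ^+ 6 = - w ^+ 2 by rewrite exprS w5 mulrN -expr2.
  have w7 : w ^+ 7 = - w ^+ 3 by rewrite exprS w6 mulrN -exprS.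
  by case: hA hB hC hD => -> [] -> [] -> [] -> // in sA sB sC sD hs hk *;
    rewrite /= ?w4 ?w5 ?w6 ?w7; ring.
- have sA := sqr_ge0 A; have sB := sqr_ge0 B; have sC := sqr_ge0 C; have sD := sqr_ge0 D.
  rewrite expr1 in hs.
  have hA : [\/ A = 0, A = 1 | A = -1] by apply: (small _ 2) => //; lia.
  have hB : [\/ B = 0, B = 1 | B = -1] by apply: (small _ 2) => //; lia.
  have hC : [\/ C = 0, C = 1 | C = -1] by apply: (small _ 2) => //; lia.
  have hD : [\/ D = 0, D = 1 | D = -1] by apply: (small _ 2) => //; lia.
  (* Two coefficients are nonzero, and the second relation leaves only the pairs A, C and B, D. The
     exponents are read off from (w - w^3) w^j = w^(j+1) - w^(j+3). *)
  pose j : nat := if A == 1 then (if C == 1 then 1%N else 7%N)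
    else if A == -1 then (if C == 1 then 3%N else 5%N)
    else if B == 1 then (if D == 1 then 2%N else 0%N) else if D == 1 then 4%N else 6%N.
  exists j => K w w4; rewrite /j {j} expr1.
  have rw k : (w - w ^+ 3) * w ^+ k = w ^+ k.+1 - w ^+ k.+3.
    by rewrite mulrBl -exprS -exprD.
  have w5 : w ^+ 5 = - w by rewrite exprS w4 mulrN1.
  have w6 : w ^+ 6 = - w ^+ 2 by rewrite exprS w5 mulrN -expr2.
  have w7 : w ^+ 7 = - w ^+ 3 by rewrite exprS w6 mulrN -exprS.
  have w8 : w ^+ 8 = 1 by rewrite exprS w7 mulrN -exprS w4 opprK.
  have w9 : w ^+ 9 = w by rewrite exprS w8 mulr1.
  have w10 : w ^+ 10 = w ^+ 2 by rewrite exprS w9 -expr2.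
  by case: hA hB hC hD => -> [] -> [] -> [] -> // in sA sB sC sD hs hk *;
    rewrite /= rw ?w4 ?w5 ?w6 ?w7 ?w8 ?w9 ?w10; ring.
(* Halving all coefficients lowers the exponent by 2, in accordance with (w - w^3)^2 = 2. *)
have [A' [B' [C' [D' [eA eB eC eD]]]]] := four_squares_even hs hk.
have [|||j hj] := IH m A' B' C' D'.
- by lia.
- by move: hs; rewrite eA eB eC eD !exprS; set N := 2 ^+ m; move: N => N; lia.
- by move: hk; rewrite eA eB eC eD; lia.
exists j => K w w4; rewrite (exprS _ m.+1) (exprS _ m) mulrA -expr2 -mulrA -hj // eA eB eC eD !intrM.
have -> : (w - w ^+ 3) ^+ 2 = 2.
  transitivity (w ^+ 2 - w ^+ 4 *+ 2 + w ^+ 4 * w ^+ 2); first by ring.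
  by rewrite w4; ring.
ring.
Qed.

(** * Eighth roots of unity and the square root of 2 *)

Section EighthRoot.
Variable R : realType.

Definition zeta8 : R[i] := expQZ R (toQZ (1 / 8%:R)).

Lemma zeta8_exp4 : zeta8 ^+ 4 = -1.
Proof.
by rewrite /zeta8 -expQZMn -toQZMn -expQZ_half; congr (expQZ _ (toQZ _)).
Qed.

Lemma zeta8X_exp4 c : odd c -> (zeta8 ^+ c) ^+ 4 = -1.
Proof. by move=> co; rewrite exprAC zeta8_exp4 -signr_odd co expr1. Qed.

Lemma zeta8X_conj c : odd c -> (zeta8 ^+ c)^* = - (zeta8 ^+ c) ^+ 3.
Proof.
move=> co; have h : zeta8 ^+ c * (zeta8 ^+ c)^* = 1.
  by rewrite /zeta8 -expQZMn expQZ_mulJ.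
apply: (@mulfI _ (zeta8 ^+ c)); last by rewrite h mulrN -exprS zeta8X_exp4 ?opprK.
by apply: contra_eq_neq h => ->; rewrite mul0r eq_sym oner_eq0.
Qed.

(** The conjugate of w = [zeta8] is -w^3, so the difference is 2 Re w = 2 cos(pi/4). *)
Lemma zeta8_sqrt2_gt0 : 0 < zeta8 - zeta8 ^+ 3.
Proof.
have := zeta8X_conj (c := 1) isT; rewrite expr1 => <-.
rewrite addcJ mulr_gt0 // ltcR /zeta8 expQZ_toQZ /= fmorph_div /= rmorph1 rmorph_nat.
apply: cos_gt0_pihalf; have := pi_gt0 R; lra.
Qed.

(** This is the Galois conjugation w -> w^c acting on the square root of 2; its sign is checked on
    the four odd classes mod 8. *)
Lemma zeta8_sqrt2X (a : int) (c : nat) : odd c -> (a = c %[mod 8])%Z ->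
  zeta8 ^+ c - (zeta8 ^+ c) ^+ 3 = (-1) ^+ ell 2 a * (zeta8 - zeta8 ^+ 3).
Proof.
move=> co ac; rewrite /ell eqxx ac.
have z8 : zeta8 ^+ 8 = 1 by rewrite (exprM _ 4 2) zeta8_exp4 sqrrN expr1n.
have -> : zeta8 ^+ c = zeta8 ^+ (c %% 8) by rewrite expr_mod.
have -> : (c = (c %% 8)%N %[mod 8])%Z by rewrite !modz_nat modn_mod.
have d8 : [\/ c %% 8 = 1, c %% 8 = 3, c %% 8 = 5 | c %% 8 = 7]%N.
  have : (c %% 8 = 1 \/ c %% 8 = 3 \/ c %% 8 = 5 \/ c %% 8 = 7)%N by lia.
  by case=> [|[|[]]] ->; [constructor 1|constructor 2|constructor 3|constructor 4].
rewrite -exprM.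
have e4 := zeta8_exp4.
have e5 : zeta8 ^+ 5 = - zeta8 by rewrite exprS e4 mulrN1.
have e7 : zeta8 ^+ 7 = - zeta8 ^+ 3 by rewrite (exprD _ 4 3) e4 mulN1r.
have e9 : zeta8 ^+ 9 = zeta8 by rewrite exprS z8 mulr1.
have e15 : zeta8 ^+ 15 = - zeta8 ^+ 3 by rewrite (exprD _ 8 7) z8 mul1r e7.
have e21 : zeta8 ^+ 21 = - zeta8 by rewrite (exprD _ 8 13) (exprD _ 8 5) z8 !mul1r e5.
by case: d8 => ->; rewrite /= ?expr1 ?mul1r ?e5 ?e7 ?e9 ?e15 ?e21 ?mulN1r ?expr0 ?mul1r; ring.
Qed.

Lemma pow_exp4N1 k : exists A B C D : int, forall w : R[i], w ^+ 4 = -1 ->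
  w ^+ k = A%:~R + B%:~R * w + C%:~R * w ^+ 2 + D%:~R * w ^+ 3.
Proof.
elim: k => [|k [A [B [C [D h]]]]].
  by exists 1, 0, 0, 0 => w _; rewrite expr0; ring.
exists (- D), A, B, C => w w4; rewrite exprS (h w w4).
transitivity (D%:~R * w ^+ 4 + A%:~R * w + B%:~R * w ^+ 2 + C%:~R * w ^+ 3); first by ring.
by rewrite w4; ring.
Qed.

(** If f(x) = k/8 the term is w^k with w = [zeta8 ^+ c]. Reduction by w^4 = -1 gives integer
    coefficients independent of [c], so that different [c] can be compared. *)
Lemma sum_eighth_roots (T : eqType) (s : seq T) (f : T -> QZ) :
  {in s, forall x, f x *+ 8 = 0} ->
  exists A B C D : int, forall c, odd c ->
    \sum_(x <- s) expQZ R (f x *+ c) = A%:~R + B%:~R * (zeta8 ^+ c)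
      + C%:~R * (zeta8 ^+ c) ^+ 2 + D%:~R * (zeta8 ^+ c) ^+ 3.
Proof.
elim: s => [|x s IH] hs.
  by exists 0, 0, 0, 0 => c _; rewrite big_nil; ring.
have [A [B [C [D h]]]] := IH (fun y ys => hs y (mem_behead (s := x :: s) ys)).
have [k ek] := QZ_torsion (n := 8) isT (hs x (mem_head x s)).
have [A' [B' [C' [D' h']]]] := pow_exp4N1 k.
exists (A + A'), (B + B'), (C + C'), (D + D') => c co; rewrite big_cons h //.
have -> : expQZ R (f x *+ c) = (zeta8 ^+ c) ^+ k.
  by rewrite exprAC /zeta8 -!expQZMn -toQZMn ek mulrnAl.
by rewrite h' ?zeta8X_exp4 // !intrD; ring.
Qed.

(** With w^4 = -1 and -w^3 as conjugate of w, the norm is an integral combination of 1 and w - w^3,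
    a square root of 2. *)
Lemma normsq_zeta8X (A B C D : int) (c : nat) : odd c ->
  `|A%:~R + B%:~R * (zeta8 ^+ c) + C%:~R * (zeta8 ^+ c) ^+ 2 + D%:~R * (zeta8 ^+ c) ^+ 3| ^+ 2
  = (A ^+ 2 + B ^+ 2 + C ^+ 2 + D ^+ 2)%:~R
    + (A * B + B * C + C * D - D * A)%:~R * (zeta8 ^+ c - (zeta8 ^+ c) ^+ 3).
Proof.
move=> co; have w4 := zeta8X_exp4 co; have wJ := zeta8X_conj co.
rewrite sqr_normc; set w := zeta8 ^+ c in w4 wJ *.
have J : (A%:~R + B%:~R * w + C%:~R * w ^+ 2 + D%:~R * w ^+ 3)^*
    = A%:~R + B%:~R * - w ^+ 3 + C%:~R * (- w ^+ 3) ^+ 2 + D%:~R * (- w ^+ 3) ^+ 3.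
  by rewrite -wJ !rmorphD !rmorphM !rmorphXn !rmorph_int.
have w6 : (- w ^+ 3) ^+ 2 = - w ^+ 2.
  by transitivity (w ^+ 4 * w ^+ 2); [ring | rewrite w4 mulN1r].
have w9 : (- w ^+ 3) ^+ 3 = - w.
  by transitivity (- (w ^+ 4) ^+ 2 * w); [ring | rewrite w4; ring].
rewrite J w6 w9; set a := A%:~R; set b := B%:~R; set c' := C%:~R; set d := D%:~R.
transitivity (a ^+ 2 + (a * b - a * d) * w - b * d * w ^+ 2
  - (a * b + b * c' + c' * d - d * a) * w ^+ 3 - (b ^+ 2 + c' ^+ 2 + d ^+ 2) * w ^+ 4
  - (b * c' + c' * d) * w ^+ 4 * w - b * d * w ^+ 4 * w ^+ 2); first by ring.
by rewrite w4 !(intrD, rmorphN, intrM, rmorphXn) /= -/a -/b -/c' -/d; ring.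
Qed.

End EighthRoot.

(** * The phase formula for p = 2 *)

Lemma phase_two (R : realType) (T : finZmodType) (psi : T -> QZ) (a : int) (e : nat) :
  (2.-group [set: T])%g -> quadratic psi -> tame psi ->
  coprimez a 2 -> #|([set: T] / perp psi)%g| = (2 ^ e)%N ->
  exists b, is_phase R psi b /\
    is_phase R (scale_quad a psi) (b *~ a + toQZ ((ell 2 a * e)%:R / 2%:R)).
Proof.
move=> pT qpsi tpsi copa he; have p_pr : prime 2 by [].
have [f hf] := gauss_normsq p_pr pT qpsi R tpsi he.
have [M [H [Mz sHM MH HM hred]]] := gauss_reduction pT qpsi.
have M8 := anisotropic_two p_pr pT qpsi Mz MH HM erefl.
have [A [B [C [D hABCD]]]] :
  exists A B C D : int, forall c, odd c ->
    \sum_(x <- enum M) expQZ R (psi x *+ c) = A%:~R + B%:~R * (zeta8 R ^+ c)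
      + C%:~R * (zeta8 R ^+ c) ^+ 2 + D%:~R * (zeta8 R ^+ c) ^+ 3.
  by apply: sum_eighth_roots => x; rewrite mem_enum => /M8.
pose r := zeta8 R - zeta8 R ^+ 3.
have r0 : 0 < r := zeta8_sqrt2_gt0 R.
have gaussE (c : nat) (b : int) : odd c -> (b = c %[mod 8])%Z ->
    gauss R (scale_quad b psi) = A%:~R + B%:~R * (zeta8 R ^+ c)
      + C%:~R * (zeta8 R ^+ c) ^+ 2 + D%:~R * (zeta8 R ^+ c) ^+ 3.
  move=> co bc; have copb : coprimez b 2.
    by rewrite /coprimez /gcdz eqz_nat -[_ == _]/(coprime _ _) coprimen2; lia.
  rewrite (hred R b copb) /gauss_on -big_enum /= -hABCD //.
  rewrite big_seq [RHS]big_seq; apply: eq_bigr => x; rewrite mem_enum => xM.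
  congr (expQZ _ _); rewrite /scale_quad.
  have h k : psi x *~ k = psi x *~ (k %% 8)%Z.
    rewrite {1}(divz_eq k 8) mulrzDr mulrC mulrzA.
    by rewrite -[psi x *~ 8]/(psi x *+ 8) M8 // mul0rz add0r.
  by rewrite h bc -h.
set m := (e + f.*2)%N in hf.
have zX (c : nat) : odd c -> `|A%:~R + B%:~R * (zeta8 R ^+ c)
      + C%:~R * (zeta8 R ^+ c) ^+ 2 + D%:~R * (zeta8 R ^+ c) ^+ 3| ^+ 2 = (2 ^ m)%:R.
  move=> co; rewrite -(gaussE c c) // hf //.
  by rewrite /coprimez /gcdz eqz_nat -[_ == _]/(coprime _ _) coprimen2.
(* c = 1 and c = 3 give opposite signs to the square root of 2 but the same norm, so its coefficient
   [K] vanishes. *)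
have n1 := zX 1%N isT; have n3 := zX 3%N isT.
rewrite normsq_zeta8X // expr1 -/r in n1.
rewrite normsq_zeta8X // (zeta8_sqrt2X R (a := 3)) // -/r in n3.
have e3 : ell 2 3 = 1%N by [].
rewrite e3 expr1 mulN1r mulrN in n3.
set Q := A ^+ 2 + B ^+ 2 + C ^+ 2 + D ^+ 2 in n1 n3.
set K := A * B + B * C + C * D - D * A in n1 n3.
have Kr0 : K%:~R * r = 0.
  have : (K%:~R * r) *+ 2 = 0.
    transitivity (Q%:~R + K%:~R * r - (Q%:~R - K%:~R * r)); first by ring.
    by rewrite n1 n3 subrr.
  by move/eqP; rewrite mulrn_eq0 /= => /eqP.
have QE : Q = 2 ^+ m.
  apply: (@intr_inj R[i]); rewrite rmorphXn /=; move: n1.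
  by rewrite Kr0 addr0 natrX.
have KE : A * B + B * C + C * D = D * A.
  move/eqP: Kr0; rewrite mulf_eq0 (gt_eqF r0) orbF intr_eq0 subr_eq0.
  by move/eqP.
(* A single [j] serves all odd c, since it is valid for every w with w^4 = -1. *)
have [j hj] := zeta8_norm_form QE KE.
have sgn k : (-1) ^+ (k * m) = (-1) ^+ (k * e) :> R[i].
  by rewrite -signr_odd -[RHS]signr_odd !oddM oddD odd_double addbF.
have gaussS (c : nat) (b : int) : odd c -> (b = c %[mod 8])%Z ->
    gauss R (scale_quad b psi) = (-1) ^+ (ell 2 b * e) * r ^+ m * (zeta8 R ^+ c) ^+ j.
  move=> co bc; rewrite (gaussE c b) // (hj _ _ (zeta8X_exp4 R co)).
  by rewrite (zeta8_sqrt2X R co bc) exprMn -(exprM _ (ell 2 b)) sgn.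
have rm0 : 0 < r ^+ m by apply: exprn_gt0.
have normG (k i : nat) : `|(-1) ^+ k * r ^+ m * (zeta8 R ^+ i) ^+ j| = r ^+ m.
  rewrite !normrM !normrX normrN1 (gtr0_norm r0) norm_expQZ !expr1n mulr1 mul1r //.
(* The Gauss sum of psi is r^m times [zeta8 R ^+ j] with r^m > 0, so its phase is j/8. *)
pose b := toQZ (1 / 8%:R) *+ j.
have b8 : b *+ 8 = 0.
  by rewrite /b mulrnAC -[_ *+ 8]toQZMn (_ : _ *+ 8 = 1%:~R) ?toQZ_int ?mul0rn.
have ph c d q : odd c -> (d = c %[mod 8])%Z ->
    expQZ R q = (-1) ^+ (ell 2 d * e) * (zeta8 R ^+ c) ^+ j -> is_phase R (scale_quad d psi) q.
  move=> co dc eq; rewrite /is_phase (gaussS c d) // -normr_eq0 normG gt_eqF //.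
  by rewrite eq mulrA [r ^+ m * _]mulrC.
have eb (d : int) (c : nat) : odd c -> (d = c %[mod 8])%Z -> expQZ R (b *~ d) = (zeta8 R ^+ c) ^+ j.
  move=> co dc; have h k : b *~ k = b *~ (k %% 8)%Z.
    rewrite {1}(divz_eq k 8) mulrzDr mulrC mulrzA.
    by rewrite -[b *~ 8]/(b *+ 8) b8 // mul0rz add0r.
  by rewrite h dc -h -[b *~ c]/(b *+ c) expQZMn /b expQZMn exprAC.
exists b; split.
  apply: (ph 1%N 1) => //; rewrite -[b]/(b *~ 1) (eb 1 1%N) //.
  by rewrite (_ : ell 2 1 = 0%N) // mul0n mul1r.
have [c [co ac]] : exists c : nat, odd c /\ (a = c %[mod 8])%Z.
  exists `|(a %% 8)%Z|%N; split; last by rewrite gez0_abs ?modz_ge0 // modz_mod.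
  by move: copa; rewrite /coprimez /gcdz eqz_nat -[_ == _]/(coprime _ _) coprimen2; lia.
by apply: (ph c a) => //; rewrite expQZD (eb a c) // expQZ_halves mulrC.
Qed.

Theorem theorem1p19 (R : realType) (p : nat) (T : finZmodType)
  (psi : T -> QZ) (a : int) (e : nat) :
  prime p ->
  (p.-group [set: T])%g ->
  quadratic psi ->
  tame psi ->
  coprimez a p%:Z ->
  #|([set: T] / perp psi)%g| = (p ^ e)%N ->
  [/\ is_phase R psi (phase R psi),
      is_phase R (scale_quad a psi) (phase R (scale_quad a psi)),
      odd p ->
        phase R (scale_quad a psi) = phase R psi + toQZ ((ell p a * e)%:R / 2%:R)
    & p = 2%N ->
        phase R (scale_quad a psi) = phase R psi *~ a + toQZ ((ell p a * e)%:R / 2%:R)].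
Proof.
move=> p_pr pT qpsi tpsi copa he.
have [p2|p_odd] := even_prime p_pr.
  subst p; have [b [hb ha]] := phase_two R pT qpsi tpsi copa he.
  by rewrite (is_phaseP hb) (is_phaseP ha); split.
have [b [hb ha]] := phase_odd R p_pr p_odd pT qpsi tpsi copa he.
rewrite (is_phaseP hb) (is_phaseP ha); split=> // p2.
by rewrite p2 in p_odd.
Qed.
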